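(* Let $n>m\ge 0$ be integers, and let $p_n$ and $q_m$ be polynomials in one complex variable with real coefficients, of degrees $n$ and $m$ respectively. Let $h(z)=p_n(z)+\overline{q_m(z)}$ for $z\in\mathbb{C}$. Then the equation $h(z)=0$ has at most $n^2-n$ solutions $z\in\mathbb{C}$ that satisfy $(\operatorname{Re} z)(\operatorname{Im} z)\neq 0$.
   Context: Solutions are counted as distinct points of $\mathbb{C}$. *)

(* Defs.v *)
From mathcomp Require Import all_boot all_order all_algebra.
From mathcomp Require Import all_classical all_reals.
From mathcomp Require Import complex.

Set Implicit Arguments.
Unset Strict Implicit.
Unset Printing Implicit Defensive.

Import Order.TTheory GRing.Theory Num.Theory.

Local Open Scope ring_scope.
Local Open Scope complex_scope.

Definition harmonic_poly (R : realType) (p q : {poly R}) (z : R[i]) : R[i] :=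
  (map_poly (real_complex R) p).[z] + conjc (map_poly (real_complex R) q).[z].

(* Main.v *)
(* At a solution z, put w = z^*.  As p and q are real, p(z) + q(w) = 0 and
   p(w) + q(z) = 0, hence (p - q)(z) = (p - q)(w); dividing by z - w, which is
   nonzero off the real axis, gives a relation of degree n - 1 whose leading
   part is a multiple of the sum of all z^a w^b with a + b = n - 1.  On the
   solution set, these relations allow us to rewrite w^(n-1) and z^n, so every
   monomial z^i w^j is a combination of those with i < n and j < n - 1.  But if
   there are k solutions, the functions 1, z, ..., z^(k-1) are linearly
   independent on them (Vandermonde), so k <= n (n - 1). *)
Require Import Defs.
From mathcomp Require Import all_boot all_order all_algebra.
From mathcomp Require Import all_classical all_reals.
From mathcomp Require Import complex.
From mathcomp Require Import zify ring.

Set Implicit Arguments.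
Unset Strict Implicit.
Unset Printing Implicit Defensive.

Import Order.TTheory GRing.Theory Num.Theory.

Local Open Scope classical_set_scope.
Local Open Scope card_scope.
Local Open Scope ring_scope.
Local Open Scope complex_scope.

(** Termwise, [a ^+ k - b ^+ k] is [a - b] times the inner sum, which is empty for [k = 0]; the
    common factor [a - b] then cancels. *)
Lemma horner_div_diff (F : fieldType) (r : {poly F}) (a b : F) :
  a != b -> r.[a] = r.[b] ->
  \sum_(k < size r) r`_k * (\sum_(i < k) a ^+ (k.-1 - i) * b ^+ i) = 0.
Proof.
move=> neq_ab rab; apply: (@mulfI _ (a - b)); first by rewrite subr_eq0.
rewrite mulr0 mulr_sumr; transitivity (r.[a] - r.[b]); last first.
  by rewrite rab subrr.
rewrite !horner_coef -sumrB; apply: eq_bigr => k _.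
by rewrite mulrCA -subrXX mulrBr.
Qed.

(** The powers of [x] are the rows of an invertible Vandermonde matrix, whose rank [k] cannot exceed
    the number of vectors spanning those rows. *)
Lemma leq_size_span_powers (F : fieldType) (k : nat) (x : 'I_k -> F)
    (X : seq 'rV[F]_k) :
  injective x ->
  (forall i, i < k -> \row_l x l ^+ i \in <<X>>%VS)%N -> (k <= size X)%N.
Proof.
move=> x_inj spanX; pose V := Vandermonde k (\row_l x l).
pose M : 'M_(size X, k) := \matrix_(r < size X) X`_r.
have V_unit : V \in unitmx.
  rewrite unitmxE unitfE det_Vandermonde; apply/prodf_neq0 => i _.
  apply/prodf_neq0 => j ltij; rewrite !mxE subr_eq0.
  by apply: contraTneq ltij => /x_inj ->; rewrite ltnn.
have sVM : (V <= M)%MS.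
  apply/row_subP => i; have -> : row i V = \row_l x l ^+ i.
    by apply/rowP => l; rewrite !mxE.
  rewrite (coord_span (X := in_tuple X) (spanX i (ltn_ord i))).
  apply: summx_sub => j _; apply: scalemx_sub.
  by have := row_sub j M; rewrite rowK.
by have := leq_trans (mxrankS sVM) (rank_leq_row M); rewrite mxrank_unit.
Qed.

(** Conjugation matters only through the two equations, so [y] stands for the conjugate of [x] and
    any field will do. *)
Lemma harmonic_pair_bound (F : fieldType) (n m k : nat) (p q : {poly F})
    (x y : 'I_k -> F) :
  (m < n)%N -> size p = n.+1 -> size q = m.+1 ->
  injective x -> (forall l, x l != y l) ->
  (forall l, p.[x l] + q.[y l] = 0) -> (forall l, p.[y l] + q.[x l] = 0) ->
  (k <= n * n.-1)%N.
Proof.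
move=> ltmn szp szq x_inj neq_xy pq0 qp0.
(* These are the values of a monomial at all the points, so a relation valid at every solution
   becomes a linear relation between vectors. *)
pose v i j : 'rV[F]_k := \row_l (x l ^+ i * y l ^+ j).
pose X := [seq v i j | i <- iota 0 n, j <- iota 0 n.-1].
have -> : (n * n.-1 = size X)%N by rewrite size_allpairs !size_iota.
have pn0 : p`_n != 0.
  by have := lead_coef_eq0 p; rewrite lead_coefE szp /= -size_poly_eq0 szp => ->.
(* The first equation, solved for [x ^+ n]: since [m < n], every term on the right has smaller total
   degree. *)
have reduce_x i j : v (n + i)%N j = - (p`_n)^-1 *:
    (\sum_(a < n) p`_a *: v (a + i)%N j + \sum_(b < m.+1) q`_b *: v i (b + j)%N).
  apply/rowP => l; rewrite !(mxE, summxE).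
  apply: (mulfI pn0); rewrite [RHS]mulrA mulrN mulfV // mulN1r.
  apply/eqP; rewrite -addr_eq0; apply/eqP.
  transitivity ((p.[x l] + q.[y l]) * (x l ^+ i * y l ^+ j)); last first.
    by rewrite pq0 mul0r.
  rewrite !horner_coef szp szq.
  rewrite [in RHS]big_ord_recr /= !mulrDl !mulr_suml addrA.
  rewrite [X in X + _ = _]addrC; congr (_ + _ + _).
  - by apply: eq_bigr => a _; rewrite !mxE exprD; ring.
  - by rewrite exprD; ring.
  - by apply: eq_bigr => b _; rewrite !mxE exprD; ring.
(* The divided difference of [p - q], solved for [y ^+ n.-1]. The first sum keeps the total degree
   but has lower degree in [y]; the second lowers the total degree, and its term [a = 0] is
   empty. *)
have reduce_y i j : v i (n.-1 + j)%N = - (p`_n)^-1 *: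
    (p`_n *: (\sum_(b < n.-1) v (n.-1 - b + i)%N (b + j)%N) +
     \sum_(a < n) (p - q)`_a *: \sum_(b < a) v (a.-1 - b + i)%N (b + j)%N).
  have szpq : size (p - q) = n.+1 by rewrite size_polyDl ?size_polyN szp ?szq.
  have pqn : (p - q)`_n = p`_n by rewrite coefB [q`_n]nth_default ?szq ?subr0.
  have pq_eq l : (p - q).[x l] = (p - q).[y l].
    apply/eqP; rewrite !hornerE -subr_eq0; apply/eqP.
    transitivity (p.[x l] + q.[y l] - (p.[y l] + q.[x l])); first by ring.
    by rewrite pq0 qp0 subrr.
  apply/rowP => l; rewrite !(mxE, summxE).
  apply: (mulfI pn0); rewrite [RHS]mulrA mulrN mulfV // mulN1r.
  apply/eqP; rewrite -addr_eq0; apply/eqP.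
  transitivity (0 * (x l ^+ i * y l ^+ j)); last by rewrite mul0r.
  rewrite -[in RHS](horner_div_diff (neq_xy l) (pq_eq l)) szpq big_ord_recr /= pqn.
  case: n ltmn pn0 @X {szp szpq pqn reduce_x} => // n' _ _ _ /=.
  rewrite mulrDl addrA [RHS]addrC; congr (_ + _).
    rewrite big_ord_recr /= subnn -mulrA -mulrDr mulrDl [in RHS]addrC mulr_suml.
    congr (_ * (_ + _)); first by rewrite exprD; ring.
    by apply: eq_bigr => b _; rewrite !mxE !exprD; ring.
  rewrite mulr_suml; apply: eq_bigr => a _.
  rewrite mxE summxE -mulrA mulr_suml; congr (_ * _).
  by apply: eq_bigr => b _; rewrite !mxE !exprD; ring.
suff v_span d i j : (i + j < d)%N -> v i j \in <<X>>%VS.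
  apply: (leq_size_span_powers x_inj) => i _.
  have -> : \row_l x l ^+ i = v i 0%N by apply/rowP => l; rewrite !mxE mulr1.
  by apply: (v_span i.+1); rewrite addn0.
(* Lexicographic induction on the total degree, then on the degree in y:
   reduce_y may keep the total degree but lowers that in y. *)
elim: d => // d IHd in i j *.
elim/ltn_ind: j => j IHj in i *; rewrite ltnS => le_ij_d.
have [le_nj | lt_jn] := leqP n.-1 j.
  rewrite -(subnKC le_nj) reduce_y memvZ // memvD //.
    rewrite memvZ // memv_suml // => b _; apply: IHj; have := ltn_ord b; lia.
  apply: memv_suml => a _; apply: memvZ; apply: memv_suml => b _; apply: IHd.
  have := ltn_ord a; have := ltn_ord b; lia.
have [le_ni | lt_in] := leqP n i.
  rewrite -(subnKC le_ni) reduce_x memvZ // memvD //;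
    apply: memv_suml => a _; apply: memvZ; apply: IHd; have := ltn_ord a; lia.
by apply/memv_span/allpairs_f; rewrite mem_iota.
Qed.

Theorem theorem1 (R : realType) (n m : nat) (p q : {poly R}) :
  (m < n)%N -> size p = n.+1 -> size q = m.+1 ->
  [set z : R[i] | harmonic_poly p q z = 0 /\ complex.Re z * complex.Im z != 0]
    #<= `I_(n ^ 2 - n)%N.
Proof.
move=> ltmn szp szq; set S := [set z | _].
(* [S] is not yet known to be finite, so the bound is proved for every finite family of distinct
   points in it; an infinite [S] would contain one too large. *)
have bound k : `I_k #<= S -> (k <= n ^ 2 - n)%N.
  move=> /card_leP[f].
  pose P (r : {poly R}) := map_poly (real_complex R) r.
  pose z (i : 'I_k) : R[i] := val (f (SigSub (mem_set (ltn_ord i : `I_k i)))).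
  have z_inj : injective z.
    move=> i j /val_inj eq_f; have [] := 'inj_f (mem_setT _) (mem_setT _) eq_f.
    exact: ord_inj.
  have z_sol i : S (z i) by apply/set_mem/valP.
  have conj_horner (r : {poly R}) (c : R[i]) :
      (P r).[c]^* = (P r).[c^*].
    rewrite -[LHS]horner_map /= /P -map_poly_comp; congr (_.[_]).
    by apply: eq_map_poly => a /=; rewrite oppr0.
  rewrite -mulnn -{3}[n]muln1 -mulnBr subn1.
  apply: (@harmonic_pair_bound _ n m k (P p) (P q) z (fun i => (z i)^*)) => //.
  - by rewrite size_map_poly.
  - by rewrite size_map_poly.
  (* A point equal to its conjugate has imaginary part zero. *)
  - move=> i; have [_ ] := z_sol i; apply: contraNneq.
    case: (z i) => a b [/eqP]; rewrite -addr_eq0 -mulr2n mulrn_eq0 /=.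
    by move=> /eqP ->; rewrite mulr0.
  - by move=> i; have [hz _] := z_sol i; rewrite -conj_horner.
  (* The second equation is the conjugate of the first, as [p] and [q] are real. *)
  - move=> i; have [hz _] := z_sol i.
    rewrite -(conj_horner p) -[(P q).[_]]conjcK -rmorphD.
    by move: hz; rewrite /harmonic_poly => ->; rewrite rmorph0.
have [[k Sk] | /infiniteP le_nat_S] := pselect (finite_set S).
  rewrite (card_le_eql Sk) card_le_II; apply: bound.
  by rewrite (card_le_eqr Sk).
have := bound (n ^ 2 - n).+1 (card_le_trans (card_leT _) le_nat_S).
by rewrite ltnn.
Qed.
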